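(* Let $G$ be a Polish group. The following conditions are equivalent. (1) $G$ has property (OB). (2) Whenever $G$ acts continuously by affine isometries on a separable Banach space, every orbit is bounded. (3) Any continuous linear representation $\pi\colon G\to \mathrm{GL}(X)$ on a separable Banach space $X$ is bounded, i.e., $\sup_{g\in G}\|\pi(g)\|<\infty$.
   Context: A Polish group is a separable, completely metrisable topological group. An action of a topological group $G$ on a topological space $X$ is continuous if the map $G\times X\to X$ is jointly continuous. A topological group $G$ has property (OB) if whenever $G$ acts continuously by isometries on a metric space, every orbit is bounded. For a Banach space $X$, $\mathrm{GL}(X)$ is the group of bounded linear automorphisms of $X$; a linear representation $\pi\colon G\to\mathrm{GL}(X)$ is called continuous if the corresponding action of $G$ on $X$ is (jointly) continuous, equivalently if $\pi$ is continuous for the strong operator topology and $\|\pi(g)\|$ is bounded for $g$ in some neighbourhood of $1\in G$. *)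

(* Defs.v *)
From HB Require Import structures.
From mathcomp Require Import all_boot all_order all_algebra.
From mathcomp Require Import all_classical all_reals all_analysis.

Set Implicit Arguments.
Unset Strict Implicit.
Unset Printing Implicit Defensive.

Import Order.TTheory GRing.Theory Num.Theory.
Import numFieldNormedType.Exports.

Local Open Scope classical_set_scope.
Local Open Scope ring_scope.

HB.mixin Record Group_isTopologicalGroup G of Topological G & Group G := {
  mulg_continuous : continuous (fun x : G * G => (x.1 * x.2)%g);
  invg_continuous : continuous (fun x : G => (x^-1)%g)
}.

#[short(type="topologicalGroupType")]
HB.structure Definition TopologicalGroup :=
  {G of Topological G & Group G & Group_isTopologicalGroup G}.

Definition separable_space (T : topologicalType) : Prop :=
  exists2 D : set T, countable D & dense D.

Definition completely_metrizable (R : realType) (T : topologicalType) : Prop :=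
  exists d : T -> T -> R,
    [/\ forall x y, d x y = 0 <-> x = y,
        forall x y, d x y = d y x,
        forall x y z, d x z <= d x y + d y z,
        forall x, nbhs x =
          filter_from [set e : R | 0 < e] (fun e => [set y | d x y < e])
      & forall u : nat -> T,
          (forall e : R, 0 < e ->
             exists N, forall m n, (N <= m)%N -> (N <= n)%N ->
               d (u m) (u n) < e) ->
          exists l : T, u @ \oo --> l].

Definition polish (R : realType) (T : topologicalType) : Prop :=
  separable_space T /\ completely_metrizable R T.

Definition is_action (G : groupType) (X : Type) (a : G -> X -> X) : Prop :=
  (forall x, a 1%g x = x) /\ (forall g h x, a (g * h)%g x = a g (a h x)).

Definition continuous_action (G : topologicalGroupType) (X : topologicalType)
    (a : G -> X -> X) : Prop :=
  is_action a /\ continuous (fun p : G * X => a p.1 p.2).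

Definition orbit_of (G X : Type) (a : G -> X -> X) (x : X) : set X :=
  range (a^~ x).

Definition isometric_map (R : realType) (M : metricType R) (f : M -> M) : Prop :=
  forall x y, mdist (f x) (f y) = mdist x y.

Definition mbounded (R : realType) (M : metricType R) (A : set M) : Prop :=
  exists r : R, forall x y, A x -> A y -> mdist x y <= r.

Definition property_OB (R : realType) (G : topologicalGroupType) : Prop :=
  forall (M : metricType R) (a : G -> M -> M),
    continuous_action a -> (forall g, isometric_map (a g)) ->
    forall x, mbounded (orbit_of a x).

Definition affine_isometry (R : realType) (X : normedModType R) (f : X -> X)
    : Prop :=
  (exists (L : {linear X -> X}) (b : X), forall x, f x = L x + b) /\
  (forall x y, `|f x - f y| = `|x - y|).

Definition affine_isometric_actions_bounded (R : realType)
    (G : topologicalGroupType) : Prop :=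
  forall (X : completeNormedModType R) (a : G -> X -> X),
    separable_space X -> continuous_action a -> (forall g, affine_isometry (a g)) ->
    forall x, bounded_set (orbit_of a x).

Section GL.
Variables (R : realType) (X : normedModType R).

(* Linearity of GLinv is omitted because it is automatic (GLinv_linear), and
   GLinv is determined by GLfun (GL_eq). *)
Record GL := MkGL {
  GLfun :> X -> X;
  GLinv : X -> X;
  GLfun_linear : linear GLfun;
  GLfun_bounded : bounded_fun_norm GLfun;
  GLinv_bounded : bounded_fun_norm GLinv;
  GLfunK : cancel GLfun GLinv;
  GLinvK : cancel GLinv GLfun
}.

HB.instance Definition _ := gen_eqMixin GL.
HB.instance Definition _ := gen_choiceMixin GL.

Lemma GL_eq (f g : GL) : GLfun f =1 GLfun g -> f = g.
Proof.
move=> fg.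
have fgi : GLinv f = GLinv g.
  by apply/funext => x; rewrite -[in RHS](GLinvK f x) fg GLfunK.
case: f g {fg} (funext fg) fgi => [f fi p1 p2 p3 p4 p5] [g gi q1 q2 q3 q4 q5].
rewrite /= => fg fgi; move: p1 p2 p3 p4 p5; rewrite fg fgi => p1 p2 p3 p4 p5.
by congr MkGL; exact: Prop_irrelevance.
Qed.

Lemma GLinv_linear (f : GL) : linear (GLinv f).
Proof.
by move=> k x y; apply: (can_inj (GLfunK f)); rewrite GLfun_linear !GLinvK.
Qed.

Lemma bounded_fun_norm_comp (f g : X -> X) :
  bounded_fun_norm f -> bounded_fun_norm g -> bounded_fun_norm (f \o g).
Proof.
move=> bf bg r; have [M gM] := bg r; have [N fN] := bf M.
by exists N => x /gM/fN.
Qed.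

Lemma linear_comp (f g : X -> X) : linear f -> linear g -> linear (f \o g).
Proof. by move=> lf lg k x y /=; rewrite lg lf. Qed.

Definition GL_one : GL :=
  @MkGL id id (fun _ _ _ => erefl) (fun r => ex_intro _ r (fun _ => id))
    (fun r => ex_intro _ r (fun _ => id)) (fun _ => erefl) (fun _ => erefl).

Definition GL_mul (f g : GL) : GL :=
  @MkGL (f \o g) (GLinv g \o GLinv f)
    (linear_comp (@GLfun_linear f) (@GLfun_linear g))
    (bounded_fun_norm_comp (@GLfun_bounded f) (@GLfun_bounded g))
    (bounded_fun_norm_comp (@GLinv_bounded g) (@GLinv_bounded f))
    (can_comp (@GLfunK f) (@GLfunK g))
    (can_comp (@GLinvK g) (@GLinvK f)).

Definition GL_inv (f : GL) : GL :=
  @MkGL (GLinv f) f (@GLinv_linear f) (@GLinv_bounded f) (@GLfun_bounded f)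
    (@GLinvK f) (@GLfunK f).

Lemma GL_mulA : associative GL_mul. Proof. by move=> f g h; exact: GL_eq. Qed.
Lemma GL_mul1 : left_id GL_one GL_mul. Proof. by move=> f; exact: GL_eq. Qed.
Lemma GL_mulr1 : right_id GL_one GL_mul. Proof. by move=> f; exact: GL_eq. Qed.
Lemma GL_mulV : left_inverse GL_one GL_inv GL_mul.
Proof. by move=> f; apply: GL_eq => x /=; rewrite GLfunK. Qed.
Lemma GL_mulrV : right_inverse GL_one GL_inv GL_mul.
Proof. by move=> f; apply: GL_eq => x /=; rewrite GLinvK. Qed.

HB.instance Definition _ :=
  isGroup.Build GL GL_mulA GL_mul1 GL_mulr1 GL_mulV GL_mulrV.

(* Extended-real-valued, so that an infinite supremum is not lost. *)
Definition opnorm (f : X -> X) : \bar R :=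
  ereal_sup [set `|f x|%:E | x in [set x : X | `|x| <= 1]].

End GL.

Definition continuous_representation (R : realType) (G : topologicalGroupType)
    (X : normedModType R) (pi : {multiplicative G -> GL X}) : Prop :=
  continuous (fun p : G * X => pi p.1 p.2).

Definition bounded_representation (R : realType) (G : topologicalGroupType)
    (X : normedModType R) (pi : {multiplicative G -> GL X}) : Prop :=
  (ereal_sup [set opnorm (pi g) | g in [set: G]] < +oo)%E.

Definition linear_representations_bounded (R : realType)
    (G : topologicalGroupType) : Prop :=
  forall (X : completeNormedModType R) (pi : {multiplicative G -> GL X}),
    separable_space X -> continuous_representation pi -> bounded_representation pi.

(* Main.v *)
From HB Require Import structures.
Require Import Defs.
From mathcomp Require Import all_boot all_order all_algebra.
From mathcomp Require Import all_classical all_reals all_analysis.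
From mathcomp Require Import zify lra.

(** Write d for the distance of a metric space M on which G acts by isometries.

- (1) implies (2) because a normed space is a metric space
  ([OB_affine_isometric_actions]).

- (2) implies (1) through an equivariant Kuratowski embedding
  ([affine_isometric_actions_OB]).  Fix a point x0 of M.  The map sending y to
  the bounded function d(., y) - d(., x0) is isometric for the sup norm, and it
  intertwines the action on M with the affine action

    f |-> f o g^-1 + (d(., g x0) - d(., x0))

  whose linear part is translation.  On the space of all bounded functions
  this action need not be continuous and the space need not be separable; both
  problems disappear on the closed linear span of the image of the orbit of x0,
  because G is separable.  The orbit of 0 is the image of the orbit of x0, so
  one is bounded as soon as the other is.

- (3) implies (2) by homogenization
  ([linear_representations_affine_isometric_actions]).  An affine map
  x |-> L x + b of X is the restriction to the hyperplane t = 1 of the linear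
  map (x, t) |-> (L x + t b, t) of X + R.  A bounded representation has a
  bounded cocycle b, that is, a bounded orbit of 0.

- (1) implies (3) is the substantial part ([OB_linear_representations]).
  Given a continuous representation pi, the sets

    U n = {g : |pi g| <= K ^ (3 ^ n) and |pi g^-1| <= K ^ (3 ^ n)}

  exhaust G and satisfy U n * U n * U n <= U n.+1, and U 0 is a neighbourhood
  of 1 if K is large.  The operator norm need not be continuous in g, so its
  logarithm does not lead to a compatible metric.  Instead ([OB_exhaustion]) the
  sequence is continued downwards by neighbourhoods of 1 shrinking to 1, each
  containing the triple products of the next, and the two-sided sequence is fed
  to the Birkhoff-Kakutani construction: the function taking the value 2 ^ n at
  the elements whose first member of the sequence has index n is replaced by its
  largest subadditive minorant, which loses only a factor 2 ([chain_le]).  This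
  gives a left-invariant metric, on which G acts continuously by translations,
  and whose bounded sets each lie in some U n.  Property (OB) says that G itself
  is bounded. *)

Set Implicit Arguments.
Unset Strict Implicit.
Unset Printing Implicit Defensive.

Import Order.TTheory GRing.Theory Num.Theory.
Import numFieldNormedType.Exports.

Local Open Scope classical_set_scope.
Local Open Scope ring_scope.

(** * Separability *)

Lemma separable_seq (T : topologicalType) (t0 : T) :
  separable_space T -> exists u : nat -> T, dense (range u).
Proof.
move=> [D cD dD].
have D0 : D !=set0.
  have [x [_ Dx]] := dD setT (ex_intro _ t0 I) openT.
  by exists x.
have [u uD] : exists u : nat -> T, D `<=` range u.
  move/countable_injP : cD => [f f_inj].
  (* Off the image of f the sequence takes the default value t0. *)
  exists (fun n => xget t0 [set x | D x /\ f x = n]) => x Dx.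
  exists (f x) => //.
  case: xgetP => [y _ [Dy fyx]|/(_ x)/not_andP[]//].
  by apply: f_inj; rewrite ?inE.
exists u => O O0 oO; have [x [Ox Dx]] := dD O O0 oO.
by exists x; split => //; exact: uD.
Qed.

Lemma dense_near (T : topologicalType) (D : set T) (t : T) (P : set T) :
  dense D -> nbhs t P -> exists2 x, D x & P x.
Proof.
move=> dD; rewrite nbhsE => -[B [oB Bt] BP].
have [x [Bx Dx]] := dD B (ex_intro _ t Bt) oB.
by exists x => //; exact: BP.
Qed.

Lemma separable_prod (S T : topologicalType) :
  separable_space S -> separable_space T -> separable_space (S * T)%type.
Proof.
move=> [A cA dA] [B cB dB]; exists (A `*` B); first exact: countableX.
move=> O [[s t] Ost] oO.
have [[P Q] [/= Ps Qt] PQ] : nbhs (s, t) O by exact: open_nbhs_nbhs.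
have [x Ax Px] := dense_near dA Ps; have [y By Qy] := dense_near dB Qt.
by exists (x, y); split; [exact: PQ | split].
Qed.

Lemma separable_real (R : realType) : separable_space R^o.
Proof.
exists (range ratr); last exact: dense_rat.
by apply: card_le_trans (card_image_le _ _) _; exact: countableP.
Qed.

(** * The closed span of a bounded sequence of functions *)

Section UniformSpan.
Variables (R : realType) (Y : Type) (e : nat -> Y -> R).

Definition ratcomb (s : seq (rat * nat)) : Y -> R :=
  fun y => \sum_(p <- s) ratr p.1 * e p.2 y.

(** Closed linear span of the family e for the uniform norm.  Approximating by
    combinations with rational coefficients makes separability immediate; the
    price is the rational approximation in [uspanZ]. *)
Definition uspan : {pred Y -> R} := fun f =>
  `[< forall eps : R, 0 < eps ->
        exists s, forall y, `|f y - ratcomb s y| <= eps >].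

Lemma uspanP f : reflect (forall eps : R, 0 < eps ->
  exists s, forall y, `|f y - ratcomb s y| <= eps) (f \in uspan).
Proof. exact: asboolP. Qed.

Lemma ratcomb_uspan s : ratcomb s \in uspan.
Proof.
by apply/uspanP => eps e0; exists s => y; rewrite subrr normr0 ltW.
Qed.

Lemma uspan_closed f :
  (forall eps : R, 0 < eps ->
     exists2 g, g \in uspan & forall y, `|f y - g y| <= eps) ->
  f \in uspan.
Proof.
move=> fg; apply/uspanP => eps e0.
have e20 : 0 < eps / 2 by rewrite divr_gt0.
have [g /uspanP /(_ _ e20)[s sP] gP] := fg _ e20.
exists s => y; rewrite [leRHS]splitr.
by rewrite (le_trans (ler_distD (g y) _ _)) ?lerD.
Qed.

Lemma uspan0 : 0 \in uspan.
Proof.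
have -> : 0 = ratcomb [::] by apply/funext => y; rewrite /ratcomb big_nil.
exact: ratcomb_uspan.
Qed.

Lemma uspanD f g : f \in uspan -> g \in uspan -> f + g \in uspan.
Proof.
move=> /uspanP fP /uspanP gP; apply/uspanP => eps e0.
have e20 : 0 < eps / 2 by rewrite divr_gt0.
have [[s sP] [t tP]] := (fP _ e20, gP _ e20).
exists (s ++ t) => y; rewrite /ratcomb big_cat/= fctE [leRHS]splitr.
by rewrite opprD addrACA (le_trans (ler_normD _ _)) ?lerD.
Qed.

Definition bounded_family := forall n, exists C, forall y, `|e n y| <= C.

Hypothesis e_bounded : bounded_family.

Lemma ratcomb_bounded s : exists C, forall y, `|ratcomb s y| <= C.
Proof.
elim: s => [|p s [C CP]].
  by exists 0 => y; rewrite /ratcomb big_nil normr0.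
have [B BP] := e_bounded p.2.
exists (`|ratr p.1| * B + C) => y; rewrite /ratcomb big_cons.
rewrite (le_trans (ler_normD _ _))//; apply: lerD; last exact: CP.
by rewrite normrM ler_wpM2l.
Qed.

Lemma uspan_bounded f :
  f \in uspan -> exists2 C, 0 <= C & forall y, `|f y| <= C.
Proof.
move=> /uspanP /(_ 1 ltr01)[s sP]; have [C CP] := ratcomb_bounded s.
exists `|1 + C| => // y; rewrite -[f y](subrK (ratcomb s y)).
by rewrite (le_trans (ler_normD _ _))// (le_trans _ (ler_norm _))// lerD.
Qed.

Lemma uspanZ_rat (q : rat) f : f \in uspan -> (fun y => ratr q * f y) \in uspan.
Proof.
move=> /uspanP fP; apply/uspanP => eps e0.
have q0 : 0 < `|ratr q : R| + 1 by rewrite ltr_wpDl.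
have [s sP] := fP (eps / (`|ratr q| + 1)) (divr_gt0 e0 q0).
exists [seq (q * p.1, p.2) | p <- s] => y.
rewrite /ratcomb big_map/=.
under eq_bigr do rewrite rmorphM -mulrA.
rewrite -mulr_sumr -mulrBr normrM (le_trans (ler_wpM2l _ (sP y)))//.
by rewrite mulrCA ler_piMr// ?(ltW e0)// ler_pdivrMr// mul1r lerDl.
Qed.

Lemma uspanZ (c : R) f : f \in uspan -> c *: f \in uspan.
Proof.
move=> fE; have [C C0 CP] := uspan_bounded fE.
apply: uspan_closed => eps e0.
have C1 : 0 < C + 1 by rewrite ltr_wpDl.
have d0 : 0 < eps / (C + 1) by rewrite divr_gt0.
(* A rational within eps / (C + 1) of c moves c *: f by at most eps. *)
have [q] : exists q : rat, ratr q \in `]c, (c + eps / (C + 1))[%R.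
  by apply: rat_in_itvoo; rewrite ltrDl.
rewrite in_itv/= => /andP[cq qc].
exists (fun y => ratr q * f y); first exact: uspanZ_rat.
move=> y; rewrite fctE -mulrBl normrM distrC.
have -> : `|ratr q - c| = ratr q - c by rewrite gtr0_norm ?subr_gt0.
rewrite (@le_trans _ _ (eps / (C + 1) * C))//.
  by apply: ler_pM; rewrite ?subr_ge0 ?(ltW cq)// lerBlDl ltW.
by rewrite -mulrA ler_piMr// ?(ltW e0)// mulrC ler_pdivrMr// mul1r lerDl.
Qed.

Lemma e_uspan n : e n \in uspan.
Proof.
have -> : e n = ratcomb [:: (1, n)].
  by apply/funext => y; rewrite /ratcomb big_seq1 rmorph1 mul1r.
exact: ratcomb_uspan.
Qed.

End UniformSpan.


(** [e_bounded] is a parameter of the type because closure under scalars and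
    finiteness of the norm depend on it. *)
Record uspan_space (R : realType) (Y : Type) (e : nat -> Y -> R)
  (e_bounded : bounded_family e) :=
  USpan { uspan_fun :> Y -> R; uspan_funP : uspan_fun \in uspan e }.
Arguments USpan {R Y e} e_bounded {uspan_fun}.

Section UspanModule.
Variables (R : realType) (Y : Type) (e : nat -> Y -> R).
Hypothesis e_bounded : bounded_family e.
Local Notation E := (uspan_space e_bounded).

HB.instance Definition _ := [isSub for @uspan_fun R Y e e_bounded].
HB.instance Definition _ := [Choice of E by <:].

Lemma uspan_ext (f g : E) : (forall y, f y = g y) -> f = g.
Proof. by move=> fg; exact/val_inj/funext. Qed.

Lemma uspan_subsemimod_closed : subsemimod_closed (uspan e).
Proof.
split; first by split; [exact: uspan0 | move=> f g; exact: uspanD].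
by move=> c f; exact: uspanZ.
Qed.

HB.instance Definition _ :=
  GRing.SubChoice_isSubLmodule.Build R (Y -> R) (uspan e) E
    uspan_subsemimod_closed.

Definition uspan_norm (f : E) : R := sup [set `|f y| | y in [set: Y]].

Lemma uspan_norm_ge (f : E) y : `|f y| <= uspan_norm f.
Proof.
apply: ub_le_sup; last by exists y.
have [C _ CP] := uspan_bounded e_bounded (uspan_funP f).
by exists C => _ [z _ <-].
Qed.

Lemma uspan_norm_le (f : E) (c : R) :
  0 <= c -> (forall y, `|f y| <= c) -> uspan_norm f <= c.
Proof.
move=> c0 fc; rewrite /uspan_norm.
have [->|/set0P n0] := eqVneq [set `|f y| | y in [set: Y]] set0.
  by rewrite sup0.
by apply: ge_sup => // _ [y _ <-].
Qed.

Lemma uspan_norm_ge0 (f : E) : 0 <= uspan_norm f.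
Proof.
have [y|noY] := pselect (exists y : Y, True).
  by case: y => y _; exact: le_trans (uspan_norm_ge f y).
rewrite /uspan_norm (_ : [set _ | _ in _] = set0) ?sup0// -subset0.
by move=> ? [y _ _]; apply: noY; exists y.
Qed.

Lemma uspan_normD (f g : E) : uspan_norm (f + g) <= uspan_norm f + uspan_norm g.
Proof.
apply: uspan_norm_le => [|y]; first by rewrite addr_ge0 ?uspan_norm_ge0.
by rewrite (le_trans (ler_normD _ _))// lerD ?uspan_norm_ge.
Qed.

Lemma uspan_norm_scale (c : R) (f : E) :
  uspan_norm (c *: f) <= `|c| * uspan_norm f.
Proof.
apply: uspan_norm_le => [|y]; first by rewrite mulr_ge0 ?uspan_norm_ge0.
by rewrite normrM ler_wpM2l ?uspan_norm_ge.
Qed.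

Lemma uspan_normZ (c : R) (f : E) : uspan_norm (c *: f) = `|c| * uspan_norm f.
Proof.
apply/eqP; rewrite eq_le uspan_norm_scale/=.
have [->|c0] := eqVneq c 0; first by rewrite normr0 mul0r uspan_norm_ge0.
rewrite -ler_pdivlMl ?normr_gt0// -normfV.
by rewrite -[leLHS]/(uspan_norm f) -{1}[f](scalerK c0) uspan_norm_scale.
Qed.

Lemma uspan_norm0_eq0 (f : E) : uspan_norm f = 0 -> f = 0.
Proof.
move=> f0; apply: uspan_ext => y; apply/eqP.
by rewrite -normr_le0 -f0 uspan_norm_ge.
Qed.

HB.instance Definition _ :=
  Lmodule_isNormed.Build R E uspan_normD uspan_normZ uspan_norm0_eq0.

Lemma uspan_le_norm (f : E) y : `|f y| <= `|f|.
Proof. exact: uspan_norm_ge. Qed.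

Lemma uspan_norm_leP (f : E) (c : R) :
  0 <= c -> (forall y, `|f y| <= c) -> `|f| <= c.
Proof. exact: uspan_norm_le. Qed.

(** A Cauchy filter converges pointwise, and the Cauchy bounds pass to the
    pointwise limit uniformly in the point, which puts the limit in the span. *)
Lemma uspan_cauchy_cvg (F : set_system E) :
  ProperFilter F -> cauchy F -> cvg F.
Proof.
move=> FF /cauchyP Fc; apply/cvg_ex.
have Fy y : cvg ((fun f : E => f y) @ F).
  apply: R_complete; apply/cauchyP => eps /Fc[f0 Ff0].
  exists (f0 y); suff : F [set f : E | ball (f0 y) eps (f y)] by [].
  apply: filterS Ff0 => f /=.
  rewrite -!ball_normE/= => ff0.
  by apply: le_lt_trans ff0; exact: (uspan_le_norm (f0 - f)).
pose l y : R := lim ((fun f : E => f y) @ F).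
have lP eps (f0 : E) : 0 < eps -> F (ball f0 eps) ->
    forall y, `|l y - f0 y| <= eps.
  move=> e0 Ff0 y; apply/ler_addgt0Pr => d d0.
  have Fl : F [set f : E | `|l y - f y| <= d].
    by have /cvgrPdist_le/(_ _ d0) := Fy y.
  have [f [/= lf]] := filter_ex (filterI Fl Ff0).
  rewrite -ball_normE/= => ff0.
  rewrite (le_trans (ler_distD (f y) _ _))// addrC lerD// distrC.
  by apply: le_trans (ltW ff0); exact: (uspan_le_norm (f0 - f)).
have lE : l \in uspan e.
  apply: uspan_closed => eps e0; have [f0 Ff0] := Fc _ e0.
  by exists f0; [exact: uspan_funP | exact: lP].
exists (USpan e_bounded lE : E); apply/cvgrPdist_le => eps e0.
have e20 : 0 < eps / 2 by rewrite divr_gt0.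
have [f0 Ff0] := Fc _ e20.
apply: filterS (Ff0) => f; rewrite -ball_normE/= => /ltW ff0.
rewrite (le_trans (ler_distD f0 _ _))// [leRHS]splitr lerD//.
by apply: uspan_norm_leP; [exact: ltW | exact: lP].
Qed.

HB.instance Definition _ := Uniform_isComplete.Build E uspan_cauchy_cvg.

Lemma uspan_separable : separable_space E.
Proof.
exists [set f : E | exists s, uspan_fun f = ratcomb e s].
  apply: (@sub_countable _ _ _ (range
    (fun s => USpan e_bounded (ratcomb_uspan e s) : E))); last first.
    by apply: card_le_trans (card_image_le _ _) _; exact: countableP.
  apply: subset_card_le => f [s fs]; exists s => //.
  by apply: val_inj => /=.
move=> O [f Of] Oopen.
have /nbhs_ballP[eps /= e0 fO] : nbhs f O by exact: open_nbhs_nbhs.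
have e20 : 0 < eps / 2 by rewrite divr_gt0.
have /uspanP/(_ _ e20)[s sP] := uspan_funP f.
exists (USpan e_bounded (ratcomb_uspan e s)); split; last by exists s.
apply: fO; rewrite -ball_normE/=.
apply: (@le_lt_trans _ _ (eps / 2)).
  by apply: uspan_norm_leP => //; exact: ltW.
by rewrite ltr_pdivrMr// ltr_pMr// ltr1n.
Qed.

End UspanModule.

(** * From affine isometric actions to isometric actions *)

Section Kuratowski.
Variables (R : realType) (G : topologicalGroupType) (M : metricType R).
Variables (a : G -> M -> M) (x0 : M) (u : nat -> G).
Hypothesis a_action : continuous_action a.
Hypothesis a_iso : forall g, isometric_map (a g).
Hypothesis u_dense : dense (range u).

Let a1 x : a 1%g x = x. Proof. exact: a_action.1.1. Qed.
Let aM g h x : a (g * h)%g x = a g (a h x). Proof. exact: a_action.1.2. Qed.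
Let aVK g x : a g^-1%g (a g x) = x. Proof. by rewrite -aM mulVg a1. Qed.
Let aKV g x : a g (a g^-1%g x) = x. Proof. by rewrite -aM mulgV a1. Qed.

Let mdist_aV g m x : mdist (a g^-1%g m) x = mdist m (a g x).
Proof. by rewrite -[LHS](a_iso g) aKV. Qed.

Lemma dist_mdist (m x y : M) : `|mdist m x - mdist m y| <= mdist x y.
Proof.
rewrite ler_norml; apply/andP; split.
  by rewrite lerNl opprB lerBlDl metric_triangle.
by rewrite lerBlDl (metric_sym x) metric_triangle.
Qed.

Lemma orbit_map_near g x (eps : R) : 0 < eps ->
  \forall h \near g, mdist (a h x) (a g x) <= eps.
Proof.
move=> e0; have cx : a h x @[h --> g] --> a g x.
  apply: (@cvg_comp _ _ _ (fun h => (h, x)) (fun p => a p.1 p.2) _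
    (nbhs (g, x))).
    by apply: cvg_pair; [exact: cvg_id | exact: cvg_cst].
  exact: (a_action.2 (g, x)).
have /metricType_numDomainType.cvgrPdist_le/(_ _ e0) := cx.
by apply: filterS => h; rewrite metric_sym.
Qed.

(** Kuratowski embedding based at x0. *)
Definition kur (x : M) : M -> R := fun m => mdist m x - mdist m x0.
Let e n := kur (a (u n) x0).

Lemma kur_bounded : bounded_family e.
Proof. by move=> n; exists (mdist (a (u n) x0) x0) => m; exact: dist_mdist. Qed.

Let E := uspan_space kur_bounded.

(** The embedding is isometric and the points a (u n) x0 are dense in the
    orbit. *)
Lemma kur_orbit_uspan g : kur (a g x0) \in uspan e.
Proof.
apply: uspan_closed => eps e0.
have [_ [n _ <-] un] := dense_near u_dense (orbit_map_near g x0 e0).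
exists (e n) => [|m]; first exact: e_uspan.
rewrite /e /kur opprB addrA subrK distrC.
by apply: le_trans un; exact: dist_mdist.
Qed.

(** Translating by g sends the embedded point y to kur (a g y) - kur (a g x0),
    so the span of the embedded orbit is invariant. *)
Lemma uspan_translate (f : M -> R) g :
  f \in uspan e -> f \o a g^-1%g \in uspan e.
Proof.
have e_translate n : e n \o a g^-1%g \in uspan e.
  have -> : e n \o a g^-1%g = kur (a (g * u n)%g x0) - kur (a g x0).
    by apply/funext => m; rewrite /e /kur/= !fctE !mdist_aV aM; lra.
  by rewrite -scaleN1r uspanD ?uspanZ ?kur_orbit_uspan//; exact: kur_bounded.
have comb_translate s : ratcomb e s \o a g^-1%g \in uspan e.
  elim: s => [|p s IHs].
    rewrite (_ : _ \o _ = 0) ?uspan0//.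
    by apply/funext => m; rewrite /ratcomb/= big_nil.
  rewrite (_ : _ \o _ = ratr p.1 *: (e p.2 \o a g^-1%g) +
      (ratcomb e s \o a g^-1%g)).
    by apply: uspanD => //; apply: (uspanZ kur_bounded).
  by apply/funext => m; rewrite /ratcomb/= big_cons.
move=> /uspanP fP; apply: uspan_closed => eps /fP[s sP].
by exists (ratcomb e s \o a g^-1%g) => // m; exact: sP.
Qed.

Definition kur_lin g (f : E) : E :=
  USpan kur_bounded (uspan_translate g (uspan_funP f)).

Definition kur_cocycle g : E := USpan kur_bounded (kur_orbit_uspan g).

Definition kur_act g (f : E) : E := kur_lin g f + kur_cocycle g.

Lemma kur_lin_linear g : linear (kur_lin g).
Proof. by move=> c f h; apply/val_inj. Qed.

HB.instance Definition _ g :=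
  GRing.isLinear.Build R E E *:%R (kur_lin g) (kur_lin_linear g).

Lemma kur_lin_norm g f : `|kur_lin g f| = `|f|.
Proof.
apply/eqP; rewrite eq_le; apply/andP; split; apply: uspan_norm_leP => // m.
  exact: (uspan_le_norm f (a g^-1%g m)).
by have := uspan_le_norm (kur_lin g f) (a g m); rewrite /= aVK.
Qed.

Lemma kur_act_affine_isometry g : affine_isometry (kur_act g).
Proof.
split; first by exists (kur_lin g : {linear E -> E}), (kur_cocycle g).
by move=> f h; rewrite opprD addrACA subrr addr0 -raddfB kur_lin_norm.
Qed.

Lemma kur_actE g f m :
  kur_act g f m = f (a g^-1%g m) + (mdist m (a g x0) - mdist m x0).
Proof. by []. Qed.

Lemma kur_act_is_action : is_action kur_act.
Proof.
split=> [f|g h f]; apply: uspan_ext => m.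
  by rewrite kur_actE a1 subrr addr0 invg1 a1.
by rewrite !kur_actE !mdist_aV -!aM -invgM; lra.
Qed.

(** Strong continuity passes to uniform limits because every [kur_lin g] is an
    isometry, so it is enough to have it for finite combinations of embedded
    orbit points, where it is continuity of the action on M. *)
Lemma kur_act_near (f : E) g (eps : R) : 0 < eps ->
  \forall h \near g, `|kur_act h f - kur_act g f| <= eps.
Proof.
move=> e0.
have shift (C D : R) m h x : mdist (a h x) (a g x) <= C ->
    mdist (a h x0) (a g x0) <= D ->
    `|kur x (a h^-1%g m) - kur x (a g^-1%g m)| <= C + D.
  move=> hC hD; rewrite /kur !mdist_aV.
  rewrite (_ : _ - _ = (mdist m (a h x) - mdist m (a g x)) -
    (mdist m (a h x0) - mdist m (a g x0))); last by lra.
  rewrite (le_trans (ler_normB _ _))// lerD//.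
    exact: le_trans (dist_mdist _ _ _) hC.
  exact: le_trans (dist_mdist _ _ _) hD.
have shift_comb s (d : R) : 0 < d -> \forall h \near g, forall m,
    `|ratcomb e s (a h^-1%g m) - ratcomb e s (a g^-1%g m)| <= d.
  elim: s d => [|p s IHs] d d0.
    apply: nearW => h m.
    by rewrite /ratcomb !big_nil subrr normr0 ltW.
  pose q := `|ratr p.1 : R| + 1.
  have q0 : 0 < q by rewrite ltr_wpDl.
  have d20 : 0 < d / 2 by rewrite divr_gt0.
  have c0 : 0 < d / 2 / q / 2 by rewrite !divr_gt0.
  near=> h => m.
  rewrite /ratcomb !big_cons opprD addrACA [leRHS]splitr.
  rewrite (le_trans (ler_normD _ _))// lerD//; last first.
    by move: m; near: h; exact: IHs.
  rewrite -mulrBr normrM (@le_trans _ _ (q * (d / 2 / q)))//; last first.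
    by rewrite mulrC divfK// gt_eqF.
  apply: ler_pM => //; first by rewrite lerDl.
  rewrite [leRHS]splitr; apply: shift; near: h; exact: orbit_map_near.
(* Two quarters pay for replacing f by a combination s, one for moving s, one
   for the cocycle. *)
have e40 : 0 < eps / 4 by rewrite divr_gt0.
have /uspanP/(_ _ e40)[s sP] := uspan_funP f.
near=> h; apply: uspan_norm_leP => [|m]; first exact: ltW.
rewrite -[uspan_fun _ _]/(kur_act h f m - kur_act g f m) !kur_actE.
have h1 : mdist (a h x0) (a g x0) <= eps / 4.
  by near: h; exact: orbit_map_near.
have h2 : `|ratcomb e s (a h^-1%g m) - ratcomb e s (a g^-1%g m)| <= eps / 4.
  by move: m; near: h; exact: shift_comb.
have := le_trans (dist_mdist m _ _) h1.
have := sP (a h^-1%g m); have := sP (a g^-1%g m).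
move: h2; rewrite !ler_norml => /andP[? ?] /andP[? ?] /andP[? ?] /andP[? ?].
by apply/andP; split; lra.
Unshelve. all: by end_near. Qed.

Lemma kur_act_continuous : continuous (fun p : G * E => kur_act p.1 p.2).
Proof.
move=> [g f]; apply/cvgrPdist_le => eps e0.
have e20 : 0 < eps / 2 by rewrite divr_gt0.
have near_g := kur_act_near f g e20.
have near_f : \forall h \near f, `|f - h| <= eps / 2.
  by have /cvgrPdist_le := @cvg_id _ (nbhs f); apply.
exists ([set h | `|kur_act h f - kur_act g f| <= eps / 2],
  [set h | `|f - h| <= eps / 2]) => // -[h k] [/= hg kf].
rewrite (le_trans (ler_distD (kur_act h f) _ _))// [leRHS]splitr lerD//.
  by rewrite distrC.
by rewrite (kur_act_affine_isometry h).2.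
Qed.

(** The value at x0 of the embedding of y is d(x0, y). *)
Lemma kur_act0_ge g : mdist x0 (a g x0) <= `|kur_act g 0|.
Proof.
have := uspan_le_norm (kur_act g 0) x0; rewrite kur_actE mdistxx subr0.
by apply: le_trans; rewrite -[X in X + _]/0 add0r ler_norm.
Qed.

End Kuratowski.

Lemma affine_isometric_actions_OB (R : realType) (G : topologicalGroupType) :
  separable_space G ->
  affine_isometric_actions_bounded R G -> property_OB R G.
Proof.
move=> sepG affG M a a_action a_iso x0.
have [u u_dense] := separable_seq 1%g sepG.
have act_cont := conj (kur_act_is_action x0 a_action a_iso u_dense)
  (@kur_act_continuous _ _ _ _ x0 _ a_action a_iso u_dense).
have [C [_ CP]] := affG _ _ (@uspan_separable _ _ _ _) act_cont
  (kur_act_affine_isometry x0 a_action a_iso u_dense) 0.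
have orbC g : mdist x0 (a g x0) <= C + 1.
  apply: le_trans (kur_act0_ge x0 a_action a_iso u_dense g) _.
  by apply: (CP (C + 1)) => //=; [rewrite ltrDl | exists g].
exists (C + 1 + (C + 1)) => _ _ [g _ <-] [h _ <-].
apply: le_trans (metric_triangle _ x0 _) _.
by rewrite lerD// metric_sym.
Qed.

(** * From isometric actions to affine isometric actions *)

Section NormedMetric.
Variables (R : realType) (X : normedModType R).

(** The alias keeps the topology of X definitionally, so that an action that is
    continuous on X is continuous here without further proof. *)
Definition normed_metric : Type := X.

HB.instance Definition _ := PseudoMetric.on normed_metric.

Let dist (x y : normed_metric) : R := `|(x : X) - y|.

Let dist_ge0 x y : 0 <= dist x y. Proof. exact: normr_ge0. Qed.

Let dist_positivity x y : dist x y = 0 -> x = y.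
Proof. by move/normr0_eq0/eqP; rewrite subr_eq0 => /eqP. Qed.

Let ball_dist (x : normed_metric) d : ball x d = [set y | dist x y < d].
Proof. by rewrite -[LHS](_ : ball (x : X) d = _)// -ball_normE. Qed.

HB.instance Definition _ := @PseudoMetric_isMetric.Build R normed_metric
  dist dist_ge0 dist_positivity ball_dist.

End NormedMetric.

Lemma OB_affine_isometric_actions (R : realType) (G : topologicalGroupType) :
  property_OB R G -> affine_isometric_actions_bounded R G.
Proof.
move=> obG X a _ a_cont a_aff x.
have [r rP] := obG (normed_metric X) a a_cont (fun g => (a_aff g).2) x.
exists (r + `|a 1%g x|); split; first exact: num_real.
move=> s rs _ [g _ <-].
have := rP _ _ (imageT _ g) (imageT _ 1%g).
rewrite -[mdist _ _]/(`|a g x - a 1%g x|) => grx.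
rewrite /=; have := ler_normD (a g x - a 1%g x) (a 1%g x); rewrite subrK => agx.
by rewrite (le_trans agx)// (le_trans _ (ltW rs))// lerD.
Qed.

(** * From linear representations to affine isometric actions *)

Section Homogenization.
Variables (R : realType) (X : completeNormedModType R).

(** X sits in this space as the hyperplane X * {1}, from which every affine map
    extends linearly.  The alias is there to carry completeness. *)
Definition homog : Type := (X * R^o)%type.

HB.instance Definition _ := NormedModule.copy homog (X * R^o)%type.

Lemma homog_cauchy_cvg (F : set_system homog) :
  ProperFilter F -> cauchy F -> cvg F.
Proof.
move=> FF /cauchyP Fc.
have F1 : cvg ((fst : homog -> X) @ F).
  apply: cauchy_cvg; apply/cauchyP => e /Fc[p Fp]; exists p.1.
  suff : F [set q | ball p.1 e q.1] by [].
  by apply: filterS Fp => q [].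
have F2 : cvg ((snd : homog -> R^o) @ F).
  apply: cauchy_cvg; apply/cauchyP => e /Fc[p Fp]; exists p.2.
  suff : F [set q | ball p.2 e q.2] by [].
  by apply: filterS Fp => q [].
apply/cvg_ex.
exists ((lim ((fst : homog -> X) @ F), lim ((snd : homog -> R^o) @ F)) : homog).
have FE : (fun q : homog => (q.1, q.2)) @ F = F.
  by rewrite (_ : (fun q => _) = id)// funeqE => -[].
by rewrite -[X in X --> _]FE; exact: (cvg_pair F1 F2).
Qed.

HB.instance Definition _ := Uniform_isComplete.Build homog homog_cauchy_cvg.
End Homogenization.

Section AffineRepresentation.
Variables (R : realType) (G : topologicalGroupType).
Variables (X : completeNormedModType R) (a : G -> X -> X).
Hypothesis a_action : continuous_action a.
Hypothesis a_aff : forall g, affine_isometry (a g).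

Let a1 x : a 1%g x = x. Proof. exact: a_action.1.1. Qed.
Let aM g h x : a (g * h)%g x = a g (a h x). Proof. exact: a_action.1.2. Qed.

Definition linear_part g (x : X) : X := a g x - a g 0.

Lemma linear_part_linear g : linear (linear_part g).
Proof.
have [[L [b Lb]] _] := a_aff g.
have LE x : linear_part g x = L x.
  by rewrite /linear_part !Lb linear0 add0r addrK.
by move=> c x y; rewrite !LE linearP.
Qed.

HB.instance Definition _ g :=
  GRing.isLinear.Build R X X *:%R (linear_part g) (linear_part_linear g).

Lemma linear_part_norm g x : `|linear_part g x| = `|x|.
Proof. by rewrite (a_aff g).2 subr0. Qed.

Definition homog_fun g (p : homog X) : homog X :=
  (linear_part g p.1 + p.2 *: a g 0, p.2).

Lemma homog_fun_linear g : linear (homog_fun g).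
Proof.
move=> c [x s] [y t]; congr (_, _) => /=.
by rewrite linearP scalerDl scalerDr scalerA addrACA.
Qed.

Lemma homog_fun_bounded g : bounded_fun_norm (homog_fun g).
Proof.
move=> r; exists (r + r * `|a g 0|) => -[x t].
rewrite /= prod_normE/= !ge_max => /andP[xr tr]; apply/andP; split.
  rewrite (le_trans (ler_normD _ _))// linear_part_norm lerD//.
  by rewrite normrZ ler_wpM2r.
by rewrite (le_trans tr)// lerDl mulr_ge0// (le_trans _ tr).
Qed.

Lemma homog_funM g h p : homog_fun (g * h)%g p = homog_fun g (homog_fun h p).
Proof.
case: p => x t; congr (_, _) => /=.
rewrite linearD linearZZ -[RHS]addrA -scalerDr /=.
rewrite [linear_part g (a h 0)]/linear_part subrK -aM; congr (_ + _).
rewrite [linear_part h x]/linear_part linearB/= /linear_part.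
by rewrite opprB addrA subrK -!aM.
Qed.

Lemma homog_fun1 p : homog_fun 1%g p = p.
Proof.
case: p => x t; congr (_, _).
by rewrite /= /linear_part !a1 subr0 scaler0 addr0.
Qed.

Lemma homog_funK g : cancel (homog_fun g) (homog_fun g^-1%g).
Proof. by move=> p; rewrite -homog_funM mulVg homog_fun1. Qed.

Lemma homog_funVK g : cancel (homog_fun g^-1%g) (homog_fun g).
Proof. by move=> p; rewrite -homog_funM mulgV homog_fun1. Qed.

Definition homog_rep g : GL (homog X) :=
  MkGL (@homog_fun_linear g) (@homog_fun_bounded g) (@homog_fun_bounded g^-1%g)
    (@homog_funK g) (@homog_funVK g).

Lemma homog_rep_multiplicative : {morph homog_rep : g h / (g * h)%g}.
Proof. by move=> g h; apply: GL_eq => p; exact: homog_funM. Qed.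

HB.instance Definition _ :=
  isMultiplicative.Build G (GL (homog X)) homog_rep homog_rep_multiplicative.

Lemma homog_rep_continuous :
  continuous_representation (homog_rep : {multiplicative G -> GL (homog X)}).
Proof.
move=> [g [x t]]; pose F := nbhs ((g, (x, t)) : G * homog X).
have cvg_g : q.1 @[q --> F] --> g by exact: cvg_fst.
have cvg_p : q.2 @[q --> F] --> ((x, t) : homog X) by exact: cvg_snd.
have cvg_x : q.2.1 @[q --> F] --> x.
  by apply: (cvg_comp _ _ cvg_p); exact: cvg_fst.
have cvg_t : q.2.2 @[q --> F] --> t.
  by apply: (cvg_comp _ _ cvg_p); exact: cvg_snd.
have act_cvg (y : G * homog X -> X) z : y q @[q --> F] --> z ->
    a q.1 (y q) @[q --> F] --> a g z.
  move=> yz; apply: (cvg_comp (fun q => (q.1, y q)) (fun p => a p.1 p.2)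
    (G := nbhs (g, z))); first exact: cvg_pair.
  exact: (a_action.2 (g, z)).
have cvg_b : a q.1 0 @[q --> F] --> a g 0.
  by apply: (act_cvg (cst 0)); exact: cvg_cst.
have cvg_1 : linear_part q.1 q.2.1 + q.2.2 *: a q.1 0
    @[q --> F] --> linear_part g x + t *: a g 0.
  have cvg_ax := act_cvg (fun q => q.2.1) x cvg_x.
  exact: (cvgD (cvgB cvg_ax cvg_b) (cvgZ cvg_t cvg_b)).
exact: cvg_pair cvg_1 cvg_t.
Qed.

(** The vector (0, 1) has norm 1 and is sent to (a g 0, 1). *)
Lemma cocycle_le_opnorm g : (`|a g 0|%:E <= opnorm (homog_rep g))%E.
Proof.
apply: (@le_trans _ _ `|homog_rep g (0, 1)|%:E).
  rewrite lee_fin prod_normE/= le_max; apply/orP; left.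
  by rewrite linear0 add0r scale1r.
apply: ereal_sup_ubound; exists (0, 1) => //=.
by rewrite prod_normE/= normr0 normr1 ge_max lexx ler01.
Qed.

End AffineRepresentation.

Lemma linear_representations_affine_isometric_actions (R : realType)
    (G : topologicalGroupType) :
  linear_representations_bounded R G -> affine_isometric_actions_bounded R G.
Proof.
move=> linG X a sepX a_action a_aff x.
have := linG (homog X) (homog_rep a_action a_aff)
  (separable_prod sepX (separable_real R))
  (@homog_rep_continuous _ _ _ _ a_action a_aff).
rewrite /bounded_representation; set S := ereal_sup _ => S_oo.
have S_ub g : (`|a g 0|%:E <= S)%E.
  apply: le_trans (cocycle_le_opnorm a_action a_aff g) _.
  by apply: ereal_sup_ubound; exists g.
have [C CS] : exists C : R, forall g, `|a g 0| <= C.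
  case: S S_oo S_ub => // [r _ rS|_ /(_ 1%g)//]; by exists r.
exists (`|x| + C); split; first exact: num_real.
move=> s xCs _ [g _ <-] /=.
have := ler_normD (a g x - a g 0) (a g 0).
rewrite subrK (a_aff g).2 subr0 => agx.
by rewrite (le_trans agx)// (le_trans _ (ltW xCs))// lerD2l.
Qed.

(** * Subadditive minorants *)

Section ChainLength.
Variables (R : realType) (G : groupType) (f : G -> R).
Hypotheses (f1 : f 1%g = 0) (f_ge0 : forall g, 0 <= f g).
Hypothesis fV : forall g, f g^-1%g = f g.
Hypothesis f_triple : forall (r : R) a b c,
  f a <= r -> f b <= r -> f c <= r -> f (a * b * c)%g <= 2 * r.

Let cost (s : seq G) : R := \sum_(x <- s) f x.
Let word (s : seq G) : G := (\prod_(x <- s) x)%g.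

Let cost_ge0 s : 0 <= cost s.
Proof. by rewrite sumr_ge0. Qed.

Let cost_cat s t : cost (s ++ t) = cost s + cost t.
Proof. by rewrite /cost big_cat. Qed.

Let cost_cons x s : cost (x :: s) = f x + cost s.
Proof. by rewrite /cost big_cons. Qed.

Let word_cat s t : word (s ++ t) = (word s * word t)%g.
Proof. by rewrite /word big_cat. Qed.

(** Cut a word at the letter where the running cost first reaches c, or at the
    last letter if it never does. *)
Lemma cost_split (s : seq G) (c : R) : s != [::] -> 0 <= c ->
  exists s1 x s2, [/\ s = s1 ++ x :: s2, cost s1 <= c &
    s2 = [::] \/ c <= cost s1 + f x].
Proof.
elim: s c => // x s IHs c _ c0.
have [cx|xc] := leP c (f x).
  exists [::], x, s; split => //; first by rewrite /cost big_nil.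
  by right; rewrite /cost big_nil add0r.
have [->|s0] := eqVneq s [::].
  by exists [::], x, [::]; split => //; [rewrite /cost big_nil | left].
have [|s1 [y [s2 [-> s1c s2P]]]] := IHs (c - f x) s0.
  by rewrite subr_ge0 ltW.
exists (x :: s1), y, s2; split => //; first by rewrite cost_cons -lerBrDl.
by case: s2P => [->|h]; [left | right; rewrite cost_cons -addrA -lerBlDl].
Qed.

(** Induction on the length of s: cut s at half its cost, as prefix, letter,
    suffix.  Prefix and suffix cost at most half the total, so f is at most the
    total cost on all three factors, and [f_triple] loses a factor 2 only
    once. *)
Lemma chain_le (s : seq G) : f (word s) <= 2 * cost s.
Proof.
have [n] := ubnP (size s); elim: n s => // n IHn s sn.
have [->|s0] := eqVneq s [::].
  by rewrite /word /cost !big_nil f1 mulr0.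
have c0 : 0 <= cost s / 2 by rewrite divr_ge0.
have [s1 [x [s2 [sE s1c s2P]]]] := cost_split s0 c0.
have costE : cost s = cost s1 + (f x + cost s2).
  by rewrite sE cost_cat cost_cons.
have s2c : cost s2 <= cost s / 2.
  case: s2P => [->|h]; first by rewrite {1}/cost big_nil.
  lra.
have szE : size s = (size s1 + (size s2).+1)%N by rewrite sE size_cat.
rewrite sE word_cat (_ : word (x :: s2) = (x * word s2)%g) ?mulgA; last first.
  by rewrite /word big_cons.
rewrite -sE; apply: f_triple.
- apply: le_trans (IHn s1 _) _; last by lra.
  by move: sn; rewrite szE; lia.
- have := cost_ge0 s1; have := cost_ge0 s2; lra.
- apply: le_trans (IHn s2 _) _; last by lra.
  by move: sn; rewrite szE; lia.
Qed.

(** The largest subadditive function below f. *)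
Definition chain_length g : R :=
  inf [set r | exists2 s, word s = g & cost s = r].
Local Notation ell := chain_length.

Let has_inf_cost g : has_inf [set r | exists2 s, word s = g & cost s = r].
Proof.
split; last by exists 0 => _ [s _ <-].
by exists (f g), [:: g]; rewrite /word /cost ?big_seq1.
Qed.

Lemma chain_length_le s : ell (word s) <= cost s.
Proof. by apply: ge_inf; [exact: (has_inf_cost _).2 | exists s]. Qed.

Lemma chain_length_ge g r : (forall s, word s = g -> r <= cost s) -> r <= ell g.
Proof.
move=> gr; apply: lb_le_inf; first exact: (has_inf_cost _).1.
by move=> _ [s sg <-]; exact: gr.
Qed.

Lemma chain_length_ge0 g : 0 <= ell g.
Proof. exact: chain_length_ge. Qed.

Lemma chain_length_le_base g : ell g <= f g.
Proof. by have := chain_length_le [:: g]; rewrite /word /cost !big_seq1. Qed.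

Lemma base_le_chain_length g : f g <= 2 * ell g.
Proof.
rewrite -ler_pdivrMl//; apply: chain_length_ge => s <-.
by rewrite ler_pdivrMl// chain_le.
Qed.

Lemma chain_length1 : ell 1%g = 0.
Proof.
by apply/eqP; rewrite eq_le chain_length_ge0 andbT -f1 chain_length_le_base.
Qed.

Lemma chain_lengthM g h : ell (g * h)%g <= ell g + ell h.
Proof.
rewrite -lerBlDr; apply: chain_length_ge => s <-.
rewrite lerBlDr -lerBlDl; apply: chain_length_ge => t <-.
by rewrite lerBlDl -cost_cat -word_cat chain_length_le.
Qed.

Lemma chain_lengthV_le g : ell g^-1%g <= ell g.
Proof.
apply: chain_length_ge => s <-.
have -> : (word s)^-1%g = word (rev [seq x^-1%g | x <- s]).
  elim: s => [|x s IHs]; first by rewrite /word !big_nil invg1.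
  rewrite map_cons rev_cons -cats1 word_cat -IHs /word big_cons big_seq1.
  by rewrite invgM.
apply: le_trans (chain_length_le _) _.
rewrite /cost (perm_big _ (permEl (perm_rev _))) big_map.
by under eq_bigr do rewrite fV.
Qed.

Lemma chain_lengthV g : ell g^-1%g = ell g.
Proof.
by apply/eqP; rewrite eq_le chain_lengthV_le -{1}[g]invgK chain_lengthV_le.
Qed.

End ChainLength.

(** * Left-invariant metrics *)

Record group_norm (R : realType) (G : groupType) (l : G -> R) : Prop :=
  GroupNorm {
  group_norm1 : l 1%g = 0;
  group_norm_eq1 : forall g, l g = 0 -> g = 1%g;
  group_normV : forall g, l g^-1%g = l g;
  group_normM : forall g h, l (g * h)%g <= l g + l h
}.

Section NormSpace.
Variables (R : realType) (G : topologicalGroupType) (l : G -> R).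
Hypothesis l_norm : group_norm l.

(** The proof is a parameter so that the left-invariant distance l (x^-1 y) can
    be attached to the type. *)
Definition norm_space of group_norm l : Type := G.
Local Notation M := (norm_space l_norm).

HB.instance Definition _ := Choice.copy M G.

Let dist (x y : M) : R := l ((x : G)^-1 * y)%g.

Let distxx x : dist x x = 0.
Proof. by rewrite /dist mulVg group_norm1. Qed.

Let dist_positivity x y : dist x y = 0 -> x = y.
Proof.
move=> /(group_norm_eq1 l_norm) xy.
by rewrite -[y : G](mulVKg (x : G)) xy mulg1.
Qed.

Let dist_sym x y : dist x y = dist y x.
Proof. by rewrite /dist -(group_normV l_norm) invgM invgK. Qed.

Let dist_triangle y x z : dist x z <= dist x y + dist y z.
Proof.
apply: le_trans (group_normM l_norm _ _).
by rewrite mulgA mulgK.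
Qed.

HB.instance Definition _ := @isMetric.Build R M dist distxx dist_positivity
  dist_sym dist_triangle.

(** G acts on [norm_space] by left translations.  The metric topology may be
    coarser than that of G, and continuity of l at 1 is enough for the action
    to be continuous. *)
Lemma OB_group_norm_bounded :
  (forall e, 0 < e -> \forall h \near (1%g : G), l h <= e) ->
  property_OB R G -> exists r, forall g, l g <= r.
Proof.
move=> l_near obG.
pose act (g : G) (x : M) : M := (g * (x : G))%g.
have act_cont : continuous_action act.
  split; first by split=> [x|g h x]; rewrite /act ?mul1g ?mulgA.
  move=> [g x]; apply/metricType_numDomainType.cvgrPdist_le => e e0.
  have e20 : 0 < e / 2 by rewrite divr_gt0.
  (* d(gx, hy) <= l (x^-1 g^-1 h x) + d(x, y): the first term is small for h
     near g because x is fixed. *)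
  have conj_near : \forall h \near g,
      l ((x : G)^-1 * (g^-1 * h) * x)%g <= e / 2.
    pose c (h : G) : G := ((x : G)^-1 * (g^-1 * h) * x)%g.
    have c_cvg : c h @[h --> g] --> (1%g : G).
      have mul_cvg (u v : G -> G) a b :
          u h @[h --> g] --> a -> v h @[h --> g] --> b ->
          (u h * v h)%g @[h --> g] --> (a * b)%g.
        move=> ua vb; apply: (cvg_comp (fun h => (u h, v h))
          (fun p : G * G => (p.1 * p.2)%g) (G := nbhs (a, b))).
          exact: cvg_pair.
        exact: (mulg_continuous (a, b)).
      have -> : (1 : G)%g = ((x : G)^-1 * (g^-1 * g) * x)%g.
        by rewrite mulVg mulg1 mulVg.
      apply: (mul_cvg _ _ _ _ _ (cvg_cst (x : G))).
      apply: (mul_cvg _ _ _ _ (cvg_cst ((x : G)^-1)%g)).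
      exact: (mul_cvg _ _ _ _ (cvg_cst (g^-1)%g) cvg_id).
    exact: (c_cvg _ (l_near _ e20)).
  have x_near : \forall y \near x, mdist x y <= e / 2.
    by have /metricType_numDomainType.cvgrPdist_le := @cvg_id _ (nbhs x); apply.
  exists ([set h | l ((x : G)^-1 * (g^-1 * h) * x)%g <= e / 2],
    [set y | mdist x y <= e / 2]) => // -[h y] [/= hg yx].
  rewrite [leRHS]splitr (le_trans _ (lerD hg yx))//.
  apply: le_trans (group_normM l_norm _ _).
  by rewrite -[mdist _ _]/(l _) !invgM !mulgA mulgK.
have act_iso g : isometric_map (act g).
  by move=> x y; rewrite -[LHS]/(l _) -[RHS]/(l _) /act invgM -mulgA mulKg.
have [r rP] := obG M act act_cont act_iso (1%g : G).
exists r => g; have := rP _ _ (imageT _ 1%g) (imageT _ g).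
by rewrite -[mdist _ _]/(l _) /act !mulg1 invg1 mul1g.
Qed.

End NormSpace.

(** * Exhaustions indexed by the integers *)

Section Exhaustion.
Variables (R : realType) (G : groupType) (W : int -> set G).
Hypothesis W1 : forall n, W n 1%g.
Hypothesis W_inv : forall n g, W n g -> W n g^-1%g.
Hypothesis W_mul3 : forall n a b c,
  W n a -> W n b -> W n c -> W (n + 1) (a * b * c)%g.
Hypothesis W_cover : forall g, exists n, W n g.

Lemma W_mono m n : m <= n -> W m `<=` W n.
Proof.
rewrite -subr_ge0 => mn g Wg.
have -> : n = m + `|n - m|%N%:Z by rewrite gez0_abs// subrKC.
elim: `|n - m|%N => [|k IHk]; first by rewrite addr0.
by rewrite -addn1 PoszD addrA -[g]mulg1 -[g]mul1g; exact: W_mul3.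
Qed.

(** The infimum is attained unless g lies in every W n, where it is 0. *)
Definition scale (g : G) : R :=
  inf [set r | exists2 n : int, W n g & 2 ^ n = r].

Let has_inf_scale g : has_inf [set r : R | exists2 n : int, W n g & 2 ^ n = r].
Proof.
split; first by have [n Wn] := W_cover g; exists (2 ^ n), n.
by exists 0 => _ [n _ <-]; rewrite exprz_ge0.
Qed.

Lemma scale_le n g : W n g -> scale g <= 2 ^ n.
Proof.
by move=> Wg; apply: ge_inf; [exact: (has_inf_scale g).2 | exists n].
Qed.

Lemma scale_lt g r : scale g < r -> exists2 n : int, W n g & 2 ^ n < r.
Proof. by move=> /(inf_lt (has_inf_scale g).1)[_ [n Wn <-] nr]; exists n. Qed.

Lemma lt_scale n g : scale g < 2 ^ n -> W n g.
Proof.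
move=> /scale_lt[m Wm mn]; apply: W_mono Wm.
by rewrite ltW// -(@ltr_eXz2l R 2)// ltr1n.
Qed.

Lemma scale_ge0 g : 0 <= scale g.
Proof.
apply: lb_le_inf; first exact: (has_inf_scale g).1.
by move=> _ [n _ <-]; rewrite exprz_ge0.
Qed.

(** A triple product of members of W n lies in W (n + 1), which doubles 2 ^ n.
    The slack e in the proof makes room for infima that are not attained. *)
Lemma scale_mul3 (r : R) a b c : scale a <= r -> scale b <= r -> scale c <= r ->
  scale (a * b * c)%g <= 2 * r.
Proof.
move=> ar br cr; apply/ler_addgt0Pr => e e0.
have re : r < r + e / 2 by rewrite ltrDl divr_gt0.
have [i Wi ir] := scale_lt (le_lt_trans ar re).
have [j Wj jr] := scale_lt (le_lt_trans br re).
have [k Wk kr] := scale_lt (le_lt_trans cr re).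
have [n [ni nj nk nr]] : exists n : int,
    [/\ i <= n, j <= n, k <= n & 2 ^ n < r + e / 2].
  exists (Order.max i (Order.max j k)).
  rewrite !le_max !lexx !orbT; split => //.
  by rewrite /Order.max; do 2?case: ifP.
have := scale_le (W_mul3 (W_mono ni Wi) (W_mono nj Wj) (W_mono nk Wk)).
rewrite exprzDr ?unitfE// expr1z; lra.
Qed.

Lemma scaleV g : scale g^-1%g = scale g.
Proof.
congr inf; apply/seteqP.
split => _ [n Wn <-]; exists n => //; last exact: W_inv.
by rewrite -[g]invgK; exact: W_inv.
Qed.

End Exhaustion.

Lemma pow2_small (R : realType) (e : R) : 0 < e -> exists k, 2 ^ Negz k < e.
Proof.
move=> e0.
have [k _ /(_ k (leqnn k))/= ke] :=
  near_infty_natSinv_lt (PosNum e0).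
exists k; rewrite NegzE -exprnN; apply: le_lt_trans ke.
by rewrite lef_pV2 ?posrE ?exprn_gt0// -natrX ler_nat ltnW// ltn_expl.
Qed.

Lemma pow2_large (R : realType) (r : R) : exists k : nat, r < 2 ^ k%:Z.
Proof.
exists (Num.truncn r).+1; apply: lt_le_trans (truncnS_gt r) _.
by rewrite -exprnP -natrX ler_nat ltnW// ltn_expl.
Qed.

(** * Exhaustions of groups with property (OB) *)

Lemma mul3_nbhs1 (G : topologicalGroupType) (A : set G) : nbhs (1%g : G) A ->
  exists B : set G, [/\ nbhs (1%g : G) B, forall g, B g -> B g^-1%g
    & forall a b c, B a -> B b -> B c -> A (a * b * c)%g].
Proof.
move=> A1.
have mul_nbhs (C : set G) : nbhs (1%g : G) C ->
    exists2 B : set G, nbhs (1%g : G) B & forall a b, B a -> B b -> C (a * b)%g.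
  move=> C1; have : nbhs ((1%g, 1%g) : G * G) [set p | C (p.1 * p.2)%g].
    by apply: (mulg_continuous (1%g, 1%g)); rewrite /= mulg1.
  move=> [[P Q] [/= P1 Q1] PQ]; exists (P `&` Q); first exact: filterI.
  by move=> a b [Pa _] [_ Qb]; exact: (PQ (a, b)).
have [C C1 CA] := mul_nbhs A A1; have [B B1 BC] := mul_nbhs C C1.
pose D := B `&` C.
have D1 : nbhs (1%g : G) D by exact: filterI.
exists [set g | D g /\ D g^-1%g]; split.
- apply: filterI => //; suff : nbhs (1%g : G) [set g | D g^-1%g] by [].
  by apply: (invg_continuous 1%g); rewrite invg1.
- by move=> g [? ?]; split; rewrite ?invgK.
- by move=> a b c [[Ba _] _] [[Bb _] _] [[_ Cc] _]; apply: CA => //; exact: BC.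
Qed.

Lemma metrizable_nbhs1 (R : realType) (G : topologicalGroupType) :
  completely_metrizable R G -> exists B : nat -> set G,
    (forall n, nbhs (1%g : G) (B n)) /\
    (forall g, (forall n, B n g) -> g = 1%g).
Proof.
move=> [d [d0 dC dT dnbhs _]].
exists (fun n => [set g | d 1%g g < n.+1%:R^-1]); split=> [n|g gB].
  by rewrite dnbhs; exists n.+1%:R^-1 => //=; rewrite invr_gt0.
have dg0 : 0 <= d 1%g g.
  have := dT 1%g g 1%g; rewrite (dC g) ((d0 _ _).2 erefl); lra.
apply/esym/d0/eqP; rewrite eq_le dg0 andbT; apply/ler_addgt0Pr => e e0.
have [n _ /(_ n (leqnn n))/= ne] := near_infty_natSinv_lt (PosNum e0).
by rewrite add0r ltW// (lt_trans (gB n)).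
Qed.

(** A cube root of a neighbourhood is a symmetric neighbourhood whose triple
    products lie in it: V n.+1 is chosen as a cube root of A n.+1 and V n
    together. *)
Lemma mul3_sequence (G : topologicalGroupType) (A : nat -> set G) :
  (forall n, nbhs (1%g : G) (A n)) ->
  exists V : nat -> set G, [/\ forall n, nbhs (1%g : G) (V n),
    forall n g, V n g -> V n g^-1%g,
    forall n a b c, V n a -> V n b -> V n c -> A n (a * b * c)%g
  & forall n a b c, V n.+1 a -> V n.+1 b -> V n.+1 c -> V n (a * b * c)%g].
Proof.
move=> A1.
pose root (C : set G) := xget setT [set D : set G |
  [/\ nbhs (1%g : G) D, forall g, D g -> D g^-1%g
    & forall a b c, D a -> D b -> D c -> C (a * b * c)%g]].
have rootP C : nbhs (1%g : G) C -> [/\ nbhs (1%g : G) (root C),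
    forall g, root C g -> root C g^-1%g
  & forall a b c, root C a -> root C b -> root C c -> C (a * b * c)%g].
  by move=> /mul3_nbhs1 exD; exact: (xgetPex setT exD).
pose V := fix V n := root (if n is n'.+1 then A n `&` V n' else A n).
have AV1 n : nbhs (1%g : G) (if n is n'.+1 then A n `&` V n' else A n).
  elim: n => // n IHn; apply: filterI => //.
  by have [] := rootP _ IHn; case: n {IHn}.
have VP n : [/\ nbhs (1%g : G) (V n), forall g, V n g -> V n g^-1%g
    & forall a b c, V n a -> V n b -> V n c ->
      (if n is n'.+1 then A n `&` V n' else A n) (a * b * c)%g].
  by have := rootP _ (AV1 n); case: n.
exists V; split=> [n|n|[|n] a b c Va Vb Vc|n a b c Va Vb Vc].
- by have [] := VP n.
- by have [] := VP n.
- by have [_ _] := VP 0%N; apply.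
- by have [_ _ /(_ a b c Va Vb Vc)[]] := VP n.+1.
- by have [_ _ /(_ a b c Va Vb Vc)[]] := VP n.+1.
Qed.

(** The sets U n, for n >= 0, and a shrinking sequence of cube roots V n, for
    negative indices, form one sequence W indexed by the integers.  Its scale is
    small near 1, vanishes only at 1, and is bounded only on subsets of the
    U n; the chain length inherits this up to a factor 2, and is a group
    norm. *)
Lemma OB_exhaustion (R : realType) (G : topologicalGroupType)
    (U : nat -> set G) :
  completely_metrizable R G -> property_OB R G ->
  nbhs (1%g : G) (U 0%N) ->
  (forall n g, U n g -> U n g^-1%g) ->
  (forall n a b c, U n a -> U n b -> U n c -> U n.+1 (a * b * c)%g) ->
  (forall g, exists n, U n g) ->
  exists n, forall g, U n g.
Proof.
move=> /metrizable_nbhs1[B [B1 BP]] obG U1 U_inv U_mul3 U_cover.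
have [|V [V1 V_inv V_mul3 V_mul3S]] :=
    @mul3_sequence G (fun n => U 0%N `&` B n).
  by move=> n; exact: filterI.
pose W (n : int) := match n with Posz n => U n | Negz n => V n end.
have W1 n : W n 1%g.
  case: n => n; last exact: (nbhs_singleton (V1 n)).
  elim: n => [|n IHn]; first exact: (nbhs_singleton U1).
  by have := U_mul3 _ _ _ _ IHn IHn IHn; rewrite !mul1g.
have W_inv n g : W n g -> W n g^-1%g.
  by case: n => n; [exact: U_inv | exact: V_inv].
have W_mul3 n a b c : W n a -> W n b -> W n c -> W (n + 1) (a * b * c)%g.
  case: n => [n|[|n]].
  - by rewrite -PoszD addn1; exact: U_mul3.
  - by move=> Wa Wb Wc; have [] := V_mul3 _ _ _ _ Wa Wb Wc.
  - rewrite (_ : Negz n.+1 + 1 = Negz n); last by rewrite !NegzE; lia.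
    exact: V_mul3S.
have W_cover g : exists n, W n g by have [n Un] := U_cover g; exists (Posz n).
have W_sep g : (forall n, W n g) -> g = 1%g.
  move=> Wg; apply: BP => n.
  have [_] := V_mul3 n _ _ _ (W1 (Negz n)) (W1 (Negz n)) (Wg (Negz n)).
  by rewrite !mul1g.
pose f : G -> R := scale R W.
have f1 : f 1%g = 0.
  apply/eqP; rewrite eq_le scale_ge0// andbT.
  apply/ler_addgt0Pr => e /pow2_small[k ke].
  by rewrite add0r (le_trans _ (ltW ke))// scale_le.
have f_ge0 g : 0 <= f g by exact: scale_ge0.
have fV g : f g^-1%g = f g by exact: scaleV.
have f_mul3 (r : R) a b c := @scale_mul3 R G W W1 W_mul3 W_cover r a b c.
pose l := chain_length f.
have l_le g : l g <= f g by exact: chain_length_le_base.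
have f_le g : f g <= 2 * l g by exact: base_le_chain_length.
have l_norm : group_norm l.
  split=> [|g lg0|g|g h].
  - exact: chain_length1.
  - apply: W_sep => n; apply: (lt_scale (R := R) W1 W_mul3 W_cover).
    by apply: le_lt_trans (f_le g) _; rewrite lg0 mulr0 exprz_gt0.
  - exact: chain_lengthV.
  - exact: chain_lengthM.
have l_near e : 0 < e -> \forall h \near (1%g : G), l h <= e.
  move=> /pow2_small[k ke]; apply: filterS (V1 k) => h Vh.
  apply: le_trans (l_le h) (le_trans _ (ltW ke)).
  exact: (scale_le R W_cover (Vh : W (Negz k) h)).
have [r rP] := OB_group_norm_bounded l_norm l_near obG.
have [n nr] := pow2_large (2 * r).
exists n => g; suff : W (Posz n) g by [].
apply: (lt_scale (R := R) W1 W_mul3 W_cover).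
by apply: le_lt_trans nr; apply: le_trans (f_le g) _; rewrite ler_pM2l.
Qed.

(** * From property (OB) to linear representations *)

Lemma linear_bound (R : realType) (X : normedModType R) (f : X -> X) (d C : R) :
  linear f -> 0 < d -> (forall x, `|x| <= d -> `|f x| <= C) ->
  forall x, `|f x| <= C / d * `|x|.
Proof.
move=> lf d0 fC x.
have f0 : f 0 = 0.
  by have := lf (-1) 0 0; rewrite scaler0 addr0 scaleN1r addNr.
have fZ c y : f (c *: y) = c *: f y by rewrite -[c *: y]addr0 lf f0 addr0.
have [->|x0] := eqVneq x 0; first by rewrite f0 !normr0 mulr0.
have nx : 0 < `|x| by rewrite normr_gt0.
have dx : 0 < d / `|x| by rewrite divr_gt0.
have := fC ((d / `|x|) *: x).
rewrite fZ (normrZ _ x) (normrZ _ (f x)) (gtr0_norm dx).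
rewrite divfK ?gt_eqF// => /(_ (lexx _)).
rewrite -ler_pdivlMl// => /le_trans; apply.
by rewrite invf_div mulrC mulrA mulrAC.
Qed.

Lemma OB_linear_representations (R : realType) (G : topologicalGroupType) :
  completely_metrizable R G ->
  property_OB R G -> linear_representations_bounded R G.
Proof.
move=> metG obG X pi _ pi_cont.
have piM g h x : pi (g * h)%g x = pi g (pi h x) by rewrite gmulfM.
(* Joint continuity at (1, 0) bounds pi on a ball, uniformly in g near 1. *)
have [K0 K0P] : exists K, \forall g \near (1%g : G),
    forall x, `|pi g x| <= K * `|x|.
  have : nbhs (1%g : G, 0 : X) [set p | `|pi p.1 p.2| < 1].
    have /cvgrPdist_lt/(_ 1 ltr01) := pi_cont (1%g, 0).
    have -> : pi 1%g 0 = 0.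
      have := @GLfun_linear _ _ (pi 1%g) (-1) 0 0.
      by rewrite scaler0 addr0 scaleN1r addNr.
    by apply: filterS => p; rewrite sub0r normrN.
  move=> [[P Q] [/= P1 /nbhs_ballP[d /= d0 dQ]] PQ].
  have d20 : 0 < d / 2 by rewrite divr_gt0.
  exists (1 / (d / 2)); apply: filterS P1 => g Pg.
  apply: linear_bound => //; first exact: GLfun_linear.
  move=> x xd; apply/ltW/(PQ (g, x)); split => //=; apply: dQ.
  rewrite -ball_normE/= sub0r normrN (le_lt_trans xd)//.
  by rewrite ltr_pdivrMr// ltr_pMr// ltr1n.
(* The summand 2 makes the powers of K unbounded. *)
pose K := `|K0| + 2.
pose c n : R := K ^+ (3 ^ n).
have K2 : 2 <= K by rewrite lerDr.
have K1 : 1 <= K by rewrite (le_trans _ K2)// ler1n.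
have c0 n : 0 <= c n by rewrite exprn_ge0// (le_trans _ K1).
have cS n : c n.+1 = c n * c n * c n.
  by rewrite /c expnSr exprM !exprS expr0 mulr1 mulrA.
pose bound C g := forall x, `|pi g x| <= C * `|x|.
pose U n := [set g | bound (c n) g /\ bound (c n) g^-1%g].
have boundM C D g h : 0 <= C -> bound C g -> bound D h ->
    bound (C * D) (g * h)%g.
  move=> C0 gC hD x; rewrite piM (le_trans (gC _))// -mulrA.
  by rewrite ler_wpM2l.
have bound_le C D g : C <= D -> bound C g -> bound D g.
  by move=> CD gC x; rewrite (le_trans (gC x))// ler_wpM2r.
have exb g : exists C, bound C g.
  have [C CP] := @GLfun_bounded _ _ (pi g) 1; exists (C / 1).
  exact: linear_bound (@GLfun_linear _ _ _) ltr01 CP.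
have [n nP] : exists n, forall g, U n g.
  apply: (OB_exhaustion metG obG).
  - have K0_near : nbhs (1%g : G) [set g | bound K0 g] by [].
    have K0V_near : nbhs (1%g : G) [set g | bound K0 g^-1%g].
      by apply: (@invg_continuous G 1%g); rewrite invg1.
    apply: filterS (filterI K0_near K0V_near) => g [gK gVK].
    have K0c : K0 <= c 0%N.
      by rewrite /c expr1 (le_trans (ler_norm _))// lerDl.
    by split; exact: bound_le K0c _.
  - by move=> k g [? ?]; split; rewrite ?invgK.
  - have cc0 k : 0 <= c k * c k by rewrite mulr_ge0.
    move=> k g h m [g1 g2] [h1 h2] [m1 m2]; rewrite /U /= cS; split.
      exact: boundM (cc0 k) (boundM _ _ _ _ (c0 k) g1 h1) m1.
    rewrite !invgM mulgA.
    exact: boundM (cc0 k) (boundM _ _ _ _ (c0 k) m2 h2) g2.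
  - move=> g; have [[C gC] [D gD]] := (exb g, exb g^-1%g).
    have cE k : k%:R <= c k.
      rewrite /c (@le_trans _ _ (2 ^+ (3 ^ k)))//.
        by rewrite -natrX ler_nat (leq_trans (ltnW (ltn_expl k (ltnSn 1))))//
          leq_exp2l// ltnW// ltn_expl.
      by rewrite lerXn2r ?nnegrE// (le_trans _ K2).
    pose k := (Num.truncn (Num.max C D)).+1.
    have : Num.max C D <= c k by rewrite (le_trans (ltW (truncnS_gt _)))// cE.
    rewrite ge_max => /andP[Ck Dk].
    by exists k; split; [exact: bound_le gC | exact: bound_le gD].
apply: (@le_lt_trans _ _ (c n)%:E); last exact: ltry.
apply: ge_ereal_sup => _ [g _ <-]; apply: ge_ereal_sup => _ [x /= x1 <-].
rewrite lee_fin (le_trans ((nP g).1 x))//.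
by rewrite ler_piMr.
Qed.

Theorem theorem1p2 (R : realType) (G : topologicalGroupType)
    (polishG : polish R G) :
  [<-> property_OB R G;
       affine_isometric_actions_bounded R G;
       linear_representations_bounded R G].
Proof.
have [sepG metG] := polishG.
tfae.
- exact: OB_affine_isometric_actions.
- move=> /(affine_isometric_actions_OB sepG).
  exact: OB_linear_representations.
- move=> /linear_representations_affine_isometric_actions.
  exact: affine_isometric_actions_OB.
Qed.
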